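(* There is an absolute constant $c>0$ such that for every $N\ge 2$, every $T$, and every online algorithm for the $N$-experts problem (without switching costs, i.e. $D=0$) with time horizon $T$, there is a time interval $I\subseteq\{1,\dots,T\}$ such that the regret of the algorithm on $I$ is at least $c\sqrt{|I|\log(NT)}$. That is, there is a segment $I$ with regret $\Omega\big(\sqrt{|I|\log(NT)}\big)$.
   Context: $N$-experts problem: there are $T$ time steps. At time $t=1,\dots,T$ the (possibly randomized) online algorithm chooses an expert $i_t\in\{1,\dots,N\}$, based only on $l_1,\dots,l_{t-1}$ and its own randomness; then the loss vector $l_t\in[0,1]^N$ is revealed and the algorithm pays $l_t(i_t)$. The loss sequence is fixed by an oblivious adversary before the first step, and $T$ is known in advance. A time interval (segment) is a set of consecutive time steps $I\subseteq\{1,\dots,T\}$. The regret of the algorithm on $I$ is the smallest $R(I)$ such that for every loss sequence $\mathbb{E}\big[\sum_{t\in I}l_t(i_t)\big]\le \min_{1\le i\le N}\sum_{t\in I}l_t(i)+R(I)$, the expectation being over the algorithm's randomness (so it is the worst-case regret over loss sequences).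
   Formalization: For nonempty I the claim fails as written (T=1, N large: regret is at most 1 but c·sqrt(log N) is unbounded); the formal theorem instead assumes log N ≤ K·T for an arbitrary K>0, with c depending only on K, and takes T≥1 and I nonempty. *)

(* Defs.v *)
From HB Require Import structures.
From mathcomp Require Import all_boot all_order all_algebra.
From mathcomp Require Import all_classical all_reals all_analysis.

Set Implicit Arguments.
Unset Strict Implicit.
Unset Printing Implicit Defensive.

Import Order.TTheory GRing.Theory Num.Theory.

Local Open Scope ring_scope.

(* Experts are numbered 0..N-1 and time steps 0..T-1. *)

Definition loss_vector (R : realType) (N : nat) := {ffun 'I_N -> R}.

Definition valid_losses (R : realType) (N T : nat)
    (l : T.-tuple (loss_vector R N)) : Prop :=
  forall (t : 'I_T) (i : 'I_N), 0 <= tnth l t i <= 1.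

(* [choice h w] is the expert chosen when the losses revealed so far are [h]
   (so at time [size h]) and the internal randomness is [w].  Past choices are
   functions of [w] and of a prefix of [h], so they need not be passed. *)
Record online_algorithm (R : realType) (N : nat) (d : measure_display)
    (Omega : measurableType d) := OnlineAlgorithm {
  choice : seq (loss_vector R N) -> Omega -> 'I_N;
  measurable_choice : forall (h : seq (loss_vector R N)) (i : 'I_N),
    measurable (choice h @^-1` [set i]%classic)
}.

Definition time_interval (T : nat) (I : {set 'I_T}) : Prop :=
  (0 < #|I|)%N /\
  forall r s t : 'I_T, r \in I -> t \in I -> (r <= s <= t)%N -> s \in I.

Section Regret.
Context (R : realType) (N T : nat) (d : measure_display)
  (Omega : measurableType d) (P : probability Omega R)
  (A : online_algorithm R N Omega).

Definition algorithm_loss (l : T.-tuple (loss_vector R N)) (I : {set 'I_T})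
    (w : Omega) : R :=
  \sum_(t in I) tnth l t (choice A (take t l) w).

(* A minimum over a nonempty family: N = 0 admits no algorithm. *)
Definition best_expert_loss (l : T.-tuple (loss_vector R N))
    (I : {set 'I_T}) : \bar R :=
  \big[Order.min/+oo%E]_(i < N) (\sum_(t in I) tnth l t i)%:E.

Definition regret_bound (I : {set 'I_T}) (r : R) : Prop :=
  forall l : T.-tuple (loss_vector R N), valid_losses l ->
    ('E_P[algorithm_loss l I] <= best_expert_loss l I + r%:E)%E.

(* The infimum is attained and lies between 0 and #|I|. *)
Definition regret (I : {set 'I_T}) : R :=
  inf [set r : R | regret_bound I r]%classic.

End Regret.

(* Main.v *)
Require Import Defs.
From HB Require Import structures.
From mathcomp Require Import all_boot all_order all_algebra.
From mathcomp Require Import all_classical all_reals all_analysis measurable_realfun.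
From mathcomp Require Import ring lra zify.

(** Two oblivious adversaries, one for each of ln N and ln T.

    If N >= T, on the first m = min (T, log2 N) steps the surviving experts are
    repeatedly halved, so that the algorithm pays at least 1/2 per step in
    expectation while some expert never pays: regret m/2, with m of order
    ln (N T) because ln N = O(T).

    If N < T, every expert always pays 1/2 except j1, whose loss is a coin.
    Take blocks of length m = log_81 T (T < 81 is trivial).  If, in some block and after some coin
    history, the algorithm plays j1 less than m/2 times in expectation against
    coins showing 1 with probability 1/4, then it has regret at least m/8
    against j1 on that block.  Otherwise, against coins showing 1 with
    probability 3/4, it plays j1 at least m / (2 * 3^m) times per block, since
    the two laws differ by a factor at most 3 per toss; over all k = T / m
    blocks its regret against the other experts is then at least
    k m / (8 * 3^m), which is enough as k >= 9^m. *)

Set Implicit Arguments.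
Unset Strict Implicit.
Unset Printing Implicit Defensive.

Import Order.TTheory GRing.Theory Num.Theory.

Local Open Scope ring_scope.

(** * Expected losses and lower bounds on the regret *)

Definition in_unit_cube (R : realType) (N : nat) : pred (loss_vector R N) :=
  fun v => [forall i, 0 <= v i <= 1].

Section ExpectedLoss.
Context (R : realType) (N : nat) (d : measure_display)
  (Omega : measurableType d) (P : probability Omega R)
  (A : online_algorithm R N Omega).
Implicit Types (h s : seq (loss_vector R N)) (v : loss_vector R N).

Definition choice_prob h (i : 'I_N) : R :=
  fine (P (Defs.choice A h @^-1` [set i])%classic).

Definition step_loss h v : R := \sum_i v i * choice_prob h i.

Lemma choice_prob_fin h i :
  (choice_prob h i)%:E = P (Defs.choice A h @^-1` [set i])%classic.
Proof. by rewrite fineK// fin_num_measure//; exact: measurable_choice. Qed.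

Lemma choice_prob_ge0 h i : 0 <= choice_prob h i.
Proof. by rewrite fine_ge0. Qed.

(** A finite combination of indicators of choice events: measurability and integrals of the loss
    reduce to those events. *)
Lemma choice_lossE h v w :
  v (Defs.choice A h w) =
  \sum_i v i * \1_((Defs.choice A h @^-1` [set i])%classic) w.
Proof.
rewrite (bigD1 (Defs.choice A h w))//= indicE mem_set// mulr1.
rewrite big1 ?addr0// => i ni; rewrite indicE memNset ?mulr0//= => e.
by rewrite e eqxx in ni.
Qed.

Lemma measurable_choice_loss h v :
  measurable_fun [set: Omega] (fun w => v (Defs.choice A h w)).
Proof.
under eq_fun do rewrite choice_lossE.
apply: measurable_sum => i; apply: measurable_funM; first exact: measurable_cst.
by apply: measurable_indic; exact: measurable_choice.
Qed.

Lemma integral_choice_loss h v : (forall i, 0 <= v i) ->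
  (\int[P]_w (v (Defs.choice A h w))%:E = (step_loss h v)%:E)%E.
Proof.
move=> v0.
under eq_integral do rewrite choice_lossE -sumEFin.
rewrite ge0_integral_sum//; last 2 first.
- move=> i; apply/measurable_EFinP/measurable_funM; first exact: measurable_cst.
  by apply: measurable_indic; exact: measurable_choice.
- by move=> i w _; rewrite lee_fin mulr_ge0.
rewrite -sumEFin; apply: eq_bigr => i _.
under eq_integral do rewrite EFinM.
rewrite ge0_integralZl_EFin//; last first.
  apply/measurable_EFinP; apply: measurable_indic; exact: measurable_choice.
rewrite integral_indic//; last exact: measurable_choice.
by rewrite setIT EFinM choice_prob_fin.
Qed.

Lemma choice_prob_sum h : \sum_i choice_prob h i = 1.
Proof.
have one_ge0 i : 0 <= ([ffun=> 1] : loss_vector R N) i by rewrite ffunE.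
have := integral_choice_loss h one_ge0.
under eq_integral do rewrite ffunE.
rewrite integral_cst// mul1e [X in X = _]probability_setT => -[->].
by apply: eq_bigr => i _; rewrite ffunE mul1r.
Qed.

Lemma expected_algorithm_loss T (l : T.-tuple (loss_vector R N)) (I : {set 'I_T}) :
  valid_losses l ->
  'E_P[algorithm_loss A l I]%E =
  (\sum_(t in I) step_loss (take t l) (tnth l t))%:E.
Proof.
move=> vl; rewrite unlock /algorithm_loss.
under eq_integral do rewrite -sumEFin -big_filter.
rewrite ge0_integral_sum//; last 2 first.
- by move=> t; apply/measurable_EFinP; exact: measurable_choice_loss.
- by move=> t w _; rewrite lee_fin; case/andP: (vl t (Defs.choice A (take t l) w)).
rewrite big_filter -sumEFin; apply: eq_bigr => t _.
by apply: integral_choice_loss => i; case/andP: (vl t i).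
Qed.

Lemma step_loss_le1 h v : in_unit_cube v -> step_loss h v <= 1.
Proof.
move=> /forallP v1; rewrite -(choice_prob_sum h); apply: ler_sum => i _.
by rewrite ler_piMl ?choice_prob_ge0//; case/andP: (v1 i).
Qed.

Lemma regret_ge T (l : T.-tuple (loss_vector R N)) (I : {set 'I_T}) j :
  valid_losses l ->
  \sum_(t in I) (step_loss (take t l) (tnth l t) - tnth l t j) <= regret P A I.
Proof.
move=> vl; apply: lb_le_inf.
  (* The infimum is bounded below by its members only once the set of bounds is nonempty; [#|I|] is
     a bound. *)
  exists #|I|%:R => l' vl' /=; rewrite expected_algorithm_loss//.
  apply: (@le_trans _ _ #|I|%:R%:E).
    rewrite lee_fin -sumr_const; apply: ler_sum => t _.
    by apply: step_loss_le1; apply/forallP => i; exact: vl'.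
  rewrite -[leLHS]add0e; apply: leeD2r.
  apply/bigmin_geP; split=> [|i _]; first exact: leey.
  by rewrite lee_fin sumr_ge0// => t _; case/andP: (vl' t i).
move=> r /(_ l vl); rewrite expected_algorithm_loss// => er.
rewrite sumrB lerBlDl -lee_fin EFinD; apply: (le_trans er).
by apply: leeD2r; exact: bigmin_le.
Qed.

(** Expected regret against [j] while [s] is revealed after [h]. It depends on the losses only, so
    an adversary that picks each loss in view of the previous ones still yields a fixed sequence. *)
Fixpoint excess (j : 'I_N) h s : R :=
  if s is v :: s' then step_loss h v - v j + excess j (rcons h v) s' else 0.

Lemma excessE j h s x0 : excess j h s =
  \sum_(0 <= t < size s) (step_loss (h ++ take t s) (nth x0 s t) - nth x0 s t j).
Proof.
elim: s h => [|v s IH] h /=; first by rewrite big_nil.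
rewrite big_nat_recl//= cats0 IH; congr (_ + _).
by apply: eq_bigr => t _; rewrite cat_rcons.
Qed.

End ExpectedLoss.

(** * Intervals of consecutive time steps *)

Definition itv_ord T a n : {set 'I_T} := [set t : 'I_T | (a <= t < a + n)%N].

Lemma big_itv_ord (V : Type) (idx : V) (op : Monoid.law idx) T a n (F : nat -> V) :
  (a + n <= T)%N ->
  \big[op/idx]_(t in itv_ord T a n) F t = \big[op/idx]_(0 <= t < n) F (a + t)%N.
Proof.
move=> anT; rewrite -[in RHS](addKn a n) -{1}(subnn a).
under [RHS]eq_bigr do rewrite addnC.
transitivity (\big[op/idx]_(0 + a <= t < a + n) F t); last first.
  by rewrite big_addn subnn.
rewrite add0n (big_nat_widen _ _ _ _ _ anT) big_geq_mkord.
by apply: eq_bigl => t; rewrite inE andbC.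
Qed.

Lemma card_itv_ord T a n : (a + n <= T)%N -> #|itv_ord T a n| = n.
Proof.
move=> anT; rewrite -sum1_card (big_itv_ord _ (fun=> 1%N) anT).
by rewrite sum_nat_const_nat subn0 muln1.
Qed.

Lemma time_interval_itv_ord T a n : (0 < n)%N -> (a + n <= T)%N ->
  time_interval (itv_ord T a n).
Proof.
move=> n0 anT; split; first by rewrite card_itv_ord.
move=> r s t; rewrite !inE => /andP[ar _] /andP[_ tn] /andP[rs st].
by rewrite (leq_trans ar rs) (leq_ltn_trans st tn).
Qed.

(** The losses [h ++ s] are padded with zeros up to the horizon; the padding comes after the
    interval and does not affect it. *)
Lemma excess_le_regret (R : realType) N d (Omega : measurableType d)
    (P : probability Omega R) (A : online_algorithm R N Omega) T
    (j : 'I_N) (h s : seq (loss_vector R N)) :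
  all (@in_unit_cube R N) h -> all (@in_unit_cube R N) s ->
  (size h + size s <= T)%N ->
  excess P A j h s <= regret P A (itv_ord T (size h) (size s)).
Proof.
move=> vh vs hsT; set x0 : loss_vector R N := [ffun=> 0].
set ls := h ++ s ++ nseq (T - (size h + size s)) x0.
have sz : size ls == T by rewrite !size_cat size_nseq addnA subnKC.
have vl : valid_losses (Tuple sz).
  move=> t; apply/forallP.
  apply: (allP (a := @in_unit_cube R N)) (mem_tnth t (Tuple sz)).
  rewrite /= !all_cat vh vs/= all_nseq; apply/orP; right.
  by apply/forallP => i; rewrite ffunE lexx ler01.
apply: le_trans (regret_ge P A (itv_ord T (size h) (size s)) j vl).
pose F t := step_loss P A (take t ls) (nth x0 ls t) - nth x0 ls t j.
under [leRHS]eq_bigr do rewrite (tnth_nth x0).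
rewrite (@big_itv_ord _ _ _ _ _ _ F hsT) (excessE P A j h s x0).
rewrite !big_mkord; apply: ler_sum => t _; rewrite /F /ls.
rewrite take_cat ltnNge leq_addr/= addKn nth_cat ltnNge leq_addr/= addKn.
by rewrite take_cat nth_cat ltn_ord lexx.
Qed.

(** * The halving adversary *)

Section Adversaries.
Context (R : realType) (N : nat) (d : measure_display)
  (Omega : measurableType d) (P : probability Omega R)
  (A : online_algorithm R N Omega).
Implicit Types (h s : seq (loss_vector R N)) (v : loss_vector R N).

Lemma exists_subset_card (T : finType) (S : {set T}) n : (n <= #|S|)%N ->
  exists2 B : {set T}, B \subset S & #|B| = n.
Proof.
move=> nS; exists [set x in take n (enum S)].
  by apply/fintype.subsetP => x; rewrite inE => /mem_take; rewrite mem_enum.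
by rewrite cardsE (card_uniqP _) ?take_uniq ?enum_uniq// size_takel// -cardE.
Qed.

(* Each step the surviving experts are split into two halves and the loss 1 is
   given either to one half or to everybody else, whichever costs the algorithm
   at least 1/2; the experts that paid nothing survive. *)
Lemma halving_adversary n (S : {set 'I_N}) h : (2 ^ n <= #|S|)%N ->
  exists s j, [/\ size s = n, all (@in_unit_cube R N) s, j \in S &
    n%:R / 2 <= excess P A j h s].
Proof.
elim: n S h => [|n IH] S h nS.
  have /card_gt0P[j jS] : (0 < #|S|)%N by apply: leq_trans nS.
  by exists [::], j; split => //=; rewrite mul0r.
rewrite expnS mul2n -addnn in nS.
have [B BS cB] := exists_subset_card (leq_trans (leq_addr _ _) nS).
pose v (C : {set 'I_N}) : loss_vector R N := [ffun i => (i \in C)%:R].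
have vE C i : v C i = (i \in C)%:R by rewrite ffunE.
have uv C : in_unit_cube (v C).
  by apply/forallP => i; rewrite vE; case: (i \in C); rewrite ?lexx ?ler01.
have sumv : step_loss P A h (v B) + step_loss P A h (v (~: B)) = 1.
  rewrite -big_split -(choice_prob_sum P A h); apply: eq_bigr => i _ /=.
  by rewrite !vE inE; case: (i \in B); rewrite ?mul0r ?mul1r ?addr0 ?add0r.
(* [C] is the set that pays, [D] the set of survivors. *)
have [C [D [CS DC cD]]] : exists C D : {set 'I_N}, [/\ 1 / 2 <= step_loss P A h (v C),
    D \subset S, [disjoint D & C] & (2 ^ n <= #|D|)%N].
  have [H|H] := lerP (1 / 2) (step_loss P A h (v B)).
    exists B, (S :\: B); split => //; first exact: finset.subsetDl.
      rewrite -finset.setI_eq0 finset.setDE -finset.setIA [~: B :&: B]finset.setIC.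
      by rewrite finset.setICr finset.setI0.
    by rewrite cardsD (finset.setIidPr BS) cB leq_subRL// (leq_trans (leq_addr _ _) nS).
  exists (~: B), B; split => //; [lra| |by rewrite cB].
  by rewrite -finset.setI_eq0 finset.setICr.
move=> cDn; have [s [j [ss us jD ej]]] := IH D (rcons h (v C)) cDn.
exists (v C :: s), j; split => /=; rewrite ?ss ?uv ?us//.
  exact: (fintype.subsetP DC).
have -> : v C j = 0 by rewrite vE (disjointFr cD).
rewrite -(natr1 n); lra.
Qed.

(** * The coin adversary *)

Context (j0 j1 : 'I_N) (j01 : j0 != j1).

Definition coin_loss (b : bool) : loss_vector R N :=
  [ffun i => if i == j1 then b%:R else 1 / 2].

Lemma unit_coin_loss b : in_unit_cube (coin_loss b).
Proof.
apply/forallP => i; rewrite ffunE; case: ifP => _; last lra.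
by case: b; rewrite ?lexx ?ler01.
Qed.

Lemma step_coin_loss h b :
  step_loss P A h (coin_loss b) = 1 / 2 + choice_prob P A h j1 * (b%:R - 1 / 2).
Proof.
rewrite /step_loss (bigD1 j1)//= ffunE eqxx.
under eq_bigr => i ij do rewrite ffunE (negPf ij).
have := choice_prob_sum P A h; rewrite (bigD1 j1)//= -big_distrr/=.
by move=> /(canRL (addKr _)) ->; field.
Qed.

(* The expected number of times [j1] is played in the next [n] steps when each
   coin shows 1 with probability [a]. *)
Fixpoint bets (a : R) n h : R :=
  if n is n'.+1 then choice_prob P A h j1
    + (a * bets a n' (rcons h (coin_loss true))
       + (1 - a) * bets a n' (rcons h (coin_loss false)))
  else 0.

Lemma bets_ge0 a n h : 0 <= a <= 1 -> 0 <= bets a n h.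
Proof.
move=> /andP[a0 a1]; elim: n h => [|n IH] h //=.
by rewrite addr_ge0 ?choice_prob_ge0// addr_ge0// mulr_ge0// subr_ge0.
Qed.

(** If [j1] is played with probability [p], a coin of mean 1/4 gives expected excess [(1 - p) / 4]
    per step. The right side is thus the mean excess, and some outcome reaches the mean. *)
Lemma excess_against_coin n h : exists x : seq bool, size x = n /\
  (n%:R - bets (1 / 4) n h) / 4 <= excess P A j1 h (map coin_loss x).
Proof.
elim: n h => [|n IH] h; first by exists [::]; split => //=; rewrite subr0 mul0r.
have [x1 [sx1]] := IH (rcons h (coin_loss true)).
have [x0 [sx0]] := IH (rcons h (coin_loss false)).
have /= H1 := step_coin_loss h true; have /= H0 := step_coin_loss h false.
have C1 : coin_loss true j1 = 1 by rewrite ffunE eqxx.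
have C0 : coin_loss false j1 = 0 by rewrite ffunE eqxx.
set e0 := excess _ _ _ _ _ => E0; set e1 := excess _ _ _ _ _ => E1.
have [L|L] := lerP ((n.+1%:R - bets (1 / 4) n.+1 h) / 4)
  (step_loss P A h (coin_loss true) - coin_loss true j1 + e1).
  by exists (true :: x1); rewrite /= sx1.
exists (false :: x0); rewrite /= sx0; split=> //.
move: L; rewrite -/e0 /= C1 C0 H1 H0 -(natr1 n); lra.
Qed.

(** The same averaging with a coin of mean 3/4: each step has expected excess [p / 4] against
    [j0]. *)
Lemma excess_against_fixed n h : exists x : seq bool, size x = n /\
  bets (3 / 4) n h / 4 <= excess P A j0 h (map coin_loss x).
Proof.
elim: n h => [|n IH] h; first by exists [::]; split => //=; rewrite mul0r.
have [x1 [sx1]] := IH (rcons h (coin_loss true)).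
have [x0 [sx0]] := IH (rcons h (coin_loss false)).
have /= H1 := step_coin_loss h true; have /= H0 := step_coin_loss h false.
have C b : coin_loss b j0 = 1 / 2 by rewrite ffunE (negPf j01).
set e0 := excess _ _ _ _ _ => E0; set e1 := excess _ _ _ _ _ => E1.
have [L|L] := lerP (bets (3 / 4) n.+1 h / 4)
  (step_loss P A h (coin_loss true) - coin_loss true j0 + e1).
  by exists (true :: x1); rewrite /= sx1.
exists (false :: x0); rewrite /= sx0; split=> //.
move: L; rewrite -/e0 /= !C H1 H0; lra.
Qed.

(* The likelihood ratio of the two coins is at most 3 per toss. *)
Lemma bets_change_of_measure n h : bets (1 / 4) n h <= 3 ^+ n * bets (3 / 4) n h.
Proof.
elim: n h => [|n IH] h /=; first by rewrite mulr0.
have := IH (rcons h (coin_loss true)); have := IH (rcons h (coin_loss false)).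
have b3 h' : 0 <= bets (3 / 4) n h' by apply: bets_ge0; lra.
have := b3 (rcons h (coin_loss true)); have := b3 (rcons h (coin_loss false)).
move: (bets _ _ _) => x0; move: (bets _ _ _) => x1.
move: (bets _ _ _) => y0; move: (bets _ _ _) => y1.
have := choice_prob_ge0 P A h j1; move: (choice_prob _ _ _ _) => p p0.
have : 1 <= 3 ^+ n :> R by rewrite exprn_ege1// ler1n.
rewrite exprS; move: (3 ^+ n) => z z1 x00 x10 y0x y1x.
have pz : p <= z * p by rewrite ler_peMl.
have zx0 : 0 <= z * x0 by rewrite mulr_ge0//; lra.
have zx1 : 0 <= z * x1 by rewrite mulr_ge0//; lra.
have zp : 0 <= z * p by rewrite mulr_ge0//; lra.
have -> : 3 * z * (p + (3 / 4 * x1 + (1 - 3 / 4) * x0)) =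
  3 * (z * p) + (9 / 4 * (z * x1) + 3 / 4 * (z * x0)) by field.
lra.
Qed.

Lemma bets_add a m n h g : 0 <= a <= 1 ->
  (forall x : seq bool, size x = m -> g <= bets a n (h ++ map coin_loss x)) ->
  bets a m h + g <= bets a (m + n) h.
Proof.
move=> /andP[a0 a1]; elim: m h => [|m IH] h gb.
  by rewrite add0r; have := gb [::] erefl; rewrite cats0.
have G b : bets a m (rcons h (coin_loss b)) + g <=
    bets a (m + n) (rcons h (coin_loss b)).
  by apply: IH => x sx; have := gb (b :: x); rewrite /= sx cat_rcons; apply.
have := ler_wpM2l a0 (G true).
have /ler_wpM2l/(_ _ _ (G false)) : 0 <= 1 - a by rewrite subr_ge0.
rewrite /= !mulrDr; lra.
Qed.

(** Each of the [k] consecutive blocks contributes at least [b] whatever coins preceded it. *)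
Lemma bets_blocks a b m k h : 0 <= a <= 1 ->
  (forall x : seq bool, (size x + m <= k * m)%N ->
    b <= bets a m (h ++ map coin_loss x)) ->
  k%:R * b <= bets a (k * m) h.
Proof.
move=> a01; elim: k h => [|k IH] h hb; first by rewrite mul0r.
rewrite mulSn -(natr1 k) mulrDl mul1r addrC.
apply: le_trans (bets_add _ (g := k%:R * b) _) => //.
  by rewrite lerD2r; have := hb [::]; rewrite cats0; apply; rewrite mulSn leq_addr.
move=> x sx; apply: IH => y sy; rewrite -catA -map_cat; apply: hb.
by rewrite size_cat sx mulSn -addnA leq_add2l.
Qed.

Lemma coin_adversary T m k : (0 < m)%N -> (0 < k)%N -> (k * m <= T)%N ->
  (exists a, (a + m <= T)%N /\ m%:R / 8 <= regret P A (itv_ord T a m)) \/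
  k%:R * m%:R / (8 * 3 ^+ m) <= regret P A (itv_ord T 0 (k * m)).
Proof.
move=> m0 k0 kmT.
have uc x : all (@in_unit_cube R N) (map coin_loss x).
  by apply/allP => _ /mapP[b _ ->]; exact: unit_coin_loss.
(* Threshold [m / 2]: at or below it, the excess against [j1] is at least
   [(m - m / 2) / 4 = m / 8]. *)
have [[x [xm Hx]]|nH] := pselect (exists x : seq bool,
  (size x + m <= k * m)%N /\ bets (1 / 4) m (map coin_loss x) <= m%:R / 2).
  left; exists (size x); split; first exact: leq_trans kmT.
  have [y [sy ey]] := excess_against_coin m (map coin_loss x).
  have := @excess_le_regret _ _ _ _ P A T j1 _ _ (uc x) (uc y).
  rewrite !size_map sy => /(_ (leq_trans xm kmT)); apply: le_trans.
  by apply: le_trans ey; lra.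
right.
have z0 : 0 < 3 ^+ m :> R by rewrite exprn_gt0.
have B : k%:R * (m%:R / 2 / 3 ^+ m) <= bets (3 / 4) (k * m) [::].
  apply: bets_blocks => [|x xm]; first lra.
  rewrite ler_pdivrMr// [leRHS]mulrC; apply: le_trans (bets_change_of_measure _ _).
  by rewrite leNgt; apply/negP => /ltW H; apply: nH; exists x.
have [y [sy ey]] := excess_against_fixed (k * m) [::].
have := @excess_le_regret _ _ _ _ P A T j0 [::] _ isT (uc y).
rewrite size_map sy => /(_ kmT); apply: le_trans; apply: le_trans ey.
apply: le_trans (ler_wpM2r _ B); last lra.
rewrite le_eqVlt; apply/orP; left; apply/eqP.
by field; rewrite gt_eqF.
Qed.

End Adversaries.

(** * Estimates for logarithms and square roots *)

Lemma sqrtr_le_sqr (R : realType) (x y : R) : 0 <= y -> x <= y ^+ 2 -> Num.sqrt x <= y.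
Proof.
by move=> y0 xy; rewrite -[leRHS](ger0_norm y0) -sqrtr_sqr ler_sqrt// sqr_ge0.
Qed.

Lemma ln_nat_le (R : realType) n : (0 < n)%N -> ln n%:R <= n%:R :> R.
Proof.
case: n => // n _; rewrite -natr1 addrC.
apply: le_trans (le_ln1Dx _) _; last by rewrite lerDr ler01.
by apply: (lt_le_trans (ltrN10 R)).
Qed.

(** With [l] the truncated logarithm, [n < p ^ l.+1], [ln p <= p], and [l.+1 <= 2 * l] since
    [l >= 1]. *)
Lemma ln_le_trunc_log (R : realType) p n : (1 < p)%N -> (p <= n)%N ->
  ln n%:R <= (2 * p * trunc_log p n)%:R :> R.
Proof.
move=> p1 pn; set l := trunc_log p n.
have p0 : (0 < p)%N by exact: ltnW.
have l1 : (1 <= l)%N by apply: trunc_log_max => //; rewrite expn1.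
apply: (@le_trans _ _ (ln (p%:R ^+ l.+1))).
  rewrite ler_ln ?posrE ?exprn_gt0 ?ltr0n//; last exact: leq_trans pn.
  by rewrite -natrX ler_nat ltnW// trunc_log_ltn.
rewrite lnXn ?ltr0n//; apply: le_trans (ler_wMn2r _ (ln_nat_le _ p0)) _.
by rewrite -mulrnA ler_nat; nia.
Qed.

Lemma ln_mul_le (R : realType) (m n : nat) : (0 < m)%N -> (m <= n)%N ->
  ln (m * n)%:R <= 2 * ln n%:R :> R.
Proof.
move=> m0 mn; have n0 := leq_trans m0 mn.
rewrite natrM lnM ?posrE ?ltr0n// mulr2n mulrDl mul1r lerD2r.
by rewrite ler_ln ?posrE ?ltr0n// ler_nat.
Qed.

(* The regret on I is at most #|I| <= T, so a lower bound of order
   sqrt (#|I| * ln (N * T)) requires ln N = O(T). *)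
Theorem theorem2p2 (R : realType) (K : R) (hK : 0 < K) :
  exists c : R, 0 < c /\
    forall N T : nat, (2 <= N)%N -> (1 <= T)%N -> ln N%:R <= K * T%:R ->
    forall (d : measure_display) (Omega : measurableType d)
      (P : probability Omega R) (A : online_algorithm R N Omega),
    exists I : {set 'I_T}, time_interval I /\
      c * Num.sqrt (#|I|%:R * ln (N * T)%:R) <= regret P A I.
Proof.
(* 324 is [2 * (2 * 81)], from [ln (N * T) <= 2 * ln T] and logarithms in base 81; [2 * K] serves
   the case where halving fills the whole horizon. *)
pose B : R := 324 + 2 * K.
have B1 : 324 <= B by rewrite /B; lra.
have B0 : 0 < B by lra.
exists (1 / (8 * B)); split; first by rewrite divr_gt0// mulr_gt0.
move=> N T N2 T1 lnN d Omega P A.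
have scale (r : R) (m L : nat) : 0 <= r -> m%:R * ln L%:R <= (B * r) ^+ 2 ->
    1 / (8 * B) * Num.sqrt (m%:R * ln L%:R) <= r / 8.
  move=> r0 /sqrtr_le_sqr; rewrite mulr_ge0 ?(ltW B0)// => /(_ isT) H.
  rewrite mul1r mulrC ler_pdivrMr ?mulr_gt0//; apply: le_trans H _.
  by rewrite le_eqVlt; apply/orP; left; apply/eqP; field.
have linear m a : (0 < m)%N -> (a + m <= T)%N -> ln (N * T)%:R <= B * m%:R ->
    m%:R / 8 <= regret P A (itv_ord T a m) ->
    exists I : {set 'I_T}, time_interval I /\
      1 / (8 * B) * Num.sqrt (#|I|%:R * ln (N * T)%:R) <= regret P A I.
  move=> m0 amT lnm Hr; exists (itv_ord T a m).
  split; first exact: time_interval_itv_ord.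
  rewrite card_itv_ord//; apply: le_trans Hr; apply: scale => //.
  apply: le_trans (ler_wpM2l (ler0n _ m) lnm) _.
  have -> : (B * m%:R) ^+ 2 = m%:R * (B * m%:R) * B by ring.
  by rewrite ler_peMr ?mulr_ge0 ?(ltW B0)//; lra.
have halving m : (0 < m <= T)%N -> (2 ^ m <= N)%N -> ln (N * T)%:R <= B * m%:R ->
    exists I : {set 'I_T}, time_interval I /\
      1 / (8 * B) * Num.sqrt (#|I|%:R * ln (N * T)%:R) <= regret P A I.
  move=> /andP[m0 mT] mN lnm; apply: (linear m 0) => //.
  have [|s [j [sm us _ sj]]] := @halving_adversary _ _ _ _ P A m [set: 'I_N] [::].
    by rewrite cardsT card_ord.
  have := @excess_le_regret _ _ _ _ P A T j [::] _ isT us.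
  rewrite sm => /(_ mT); apply: le_trans; apply: le_trans sj.
  by have := ler0n R m; lra.
have m0R m : 0 <= m%:R :> R by exact: ler0n.
have [TN|NT] := leqP T N.
  have lnNT : ln (N * T)%:R <= 2 * ln N%:R :> R by rewrite mulnC ln_mul_le.
  have l1 : (0 < trunc_log 2 N)%N by apply: trunc_log_max.
  (* If halving could outlast the horizon, [ln N <= K * T] makes [T] rounds enough. *)
  have [Tl|/ltnW lT] := leqP T (trunc_log 2 N).
    apply: (halving T); first by rewrite T1 leqnn.
      apply: (@leq_trans (2 ^ trunc_log 2 N)); first by rewrite leq_exp2l.
      by apply: trunc_logP => //; exact: ltnW.
    by rewrite /B; have := m0R T; lra.
  apply: (halving (trunc_log 2 N)); first by rewrite l1.
    by apply: trunc_logP => //; exact: ltnW.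
  have := ln_le_trunc_log R (isT : (1 < 2)%N) N2; rewrite natrM.
  have : 0 <= K * (trunc_log 2 N)%:R by rewrite mulr_ge0// ltW.
  by rewrite /B; have := m0R (trunc_log 2 N); lra.
have lnNT : ln (N * T)%:R <= 2 * ln T%:R :> R by rewrite ln_mul_le// ltnW// ltnW.
(* For [T < 81] the logarithm is bounded, so one halving step suffices. *)
have [T81|T81] := ltnP T 81.
  apply: (halving 1%N) => //; apply: le_trans lnNT _.
  have := ln_nat_le R T1; have : T%:R <= 81 :> R by rewrite ler_nat ltnW.
  by lra.
pose m := trunc_log 81 T; pose k := (T %/ m)%N.
have m1 : (0 < m)%N by apply: trunc_log_max.
(* [9 ^ m * m <= 9 ^ m * 9 ^ m = 81 ^ m <= T]. *)
have k9 : (9 ^ m <= k)%N.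
  rewrite leq_divRL//; apply: (@leq_trans (81 ^ m)); last exact: trunc_logP.
  by rewrite (expnMn 9 9) leq_mul2l orbC ltnW// ltn_expl.
have k0 : (0 < k)%N by apply: leq_trans k9; rewrite expn_gt0.
have lnm : ln (N * T)%:R <= B * m%:R.
  have := ln_le_trunc_log R (isT : (1 < 81)%N) T81; rewrite -/m natrM.
  have : 324 * m%:R <= B * m%:R by rewrite ler_wpM2r.
  by lra.
have kmT : (k * m <= T)%N by exact: leq_trunc_div.
have j01 : Ordinal (ltnW N2) != Ordinal N2 by [].
have [[a [amT Ha]]|Hk] := coin_adversary P A j01 m1 k0 kmT.
  exact: (linear m a).
exists (itv_ord T 0 (k * m)); split.
  by apply: time_interval_itv_ord; rewrite // muln_gt0 k0.
rewrite card_itv_ord//; apply: le_trans Hk.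
have z0 : 0 < 3 ^+ m :> R by rewrite exprn_gt0.
have -> : k%:R * m%:R / (8 * 3 ^+ m) = k%:R * m%:R / 3 ^+ m / 8 :> R.
  by field; rewrite gt_eqF.
apply: scale; first by rewrite divr_ge0 ?mulr_ge0// ltW.
rewrite natrM; apply: le_trans (ler_wpM2l _ lnm) _; first by rewrite mulr_ge0.
(* The last factor is at least 1 because [k >= 9 ^ m]; this is why the blocks have logarithmic
   length in base 81. *)
have -> : (B * (k%:R * m%:R / 3 ^+ m)) ^+ 2 =
    k%:R * m%:R * (B * m%:R) * (B * (k%:R / 9 ^+ m)) :> R.
  have -> : 9 ^+ m = 3 ^+ m * 3 ^+ m :> R by rewrite -exprMn; congr (_ ^+ _); ring.
  by field; rewrite gt_eqF.
rewrite ler_peMr ?mulr_ge0 ?(ltW B0)//.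
apply: mulr_ege1; first lra.
by rewrite ler_pdivlMr ?exprn_gt0// mul1r -natrX ler_nat.
Qed.
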